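(* Let $n\ge2$, let $(L,[\cdot,\dots,\cdot],\varepsilon)$ be an $n$-Lie color algebra and let $\alpha:L\to L$ be an even endomorphism of $L$. Then $L_\alpha=(L,\{\cdot,\dots,\cdot\},\varepsilon,\alpha)$, where $\{x_1,\dots,x_n\}=\alpha([x_1,\dots,x_n])$, is a multiplicative $n$-Hom-Lie color algebra.
   Context: $G$ is an abelian group with neutral element $e$ (operation written $+$), $\mathbb{K}$ is a field of characteristic different from 2. A $G$-graded linear space is $V=\bigoplus_{a\in G}V_a$ over $\mathbb{K}$; $\mathcal{H}(V)$ is its set of homogeneous elements; a linear map $f:V\to V'$ is even if $f(V_a)\subseteq V'_a$ for all $a$. A (skew-symmetric) bicharacter is a map $\varepsilon:G\times G\to\mathbb{K}^*$ with $\varepsilon(a,b)\varepsilon(b,a)=1$, $\varepsilon(a,b+c)=\varepsilon(a,b)\varepsilon(a,c)$, $\varepsilon(a+b,c)=\varepsilon(a,c)\varepsilon(b,c)$. For homogeneous $x,y$ one writes $\varepsilon(x,y)$ for $\varepsilon(\deg x,\deg y)$, and sums of homogeneous elements inside $\varepsilon$ denote sums of their degrees. An $n$-Hom-Lie color algebra $(L,[\cdot,\dots,\cdot],\varepsilon,\alpha)$ is a $G$-graded linear space $L$ with an $n$-linear map $[\cdot,\dots,\cdot]:L^n\to L$, a bicharacter $\varepsilon$ and an even linear map $\alpha:L\to L$ such that for all $x_i,y_j\in\mathcal{H}(L)$: (1) $[x_1,\dots,x_i,x_{i+1},\dots,x_n]=-\varepsilon(x_i,x_{i+1})[x_1,\dots,x_{i+1},x_i,\dots,x_n]$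 for $1\le i\le n-1$; (2) $[\alpha(x_1),\dots,\alpha(x_{n-1}),[y_1,\dots,y_n]]=\sum_{i=1}^n\varepsilon(X,Y_i)[\alpha(y_1),\dots,\alpha(y_{i-1}),[x_1,\dots,x_{n-1},y_i],\alpha(y_{i+1}),\dots,\alpha(y_n)]$, where $X=x_1+\dots+x_{n-1}$, $Y_i=y_1+\dots+y_{i-1}$ (sums of degrees, $Y_1=e$). An $n$-Lie color algebra is the case $\alpha=\mathrm{id}$. An endomorphism of $L$ is a linear map $L\to L$ preserving the bracket. An $n$-Hom-Lie color algebra is multiplicative if its twisting map $\alpha$ is an endomorphism, i.e. preserves its bracket. *)

(* Defs.v *)
From mathcomp Require Import all_boot all_algebra perm.
Set Implicit Arguments.
Unset Strict Implicit.
Unset Printing Implicit Defensive.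
Import GRing.Theory.
Local Open Scope ring_scope.

Section Graded.
Variables (G : zmodType) (K : fieldType) (L : lmodType K).

Definition is_subspace (P : L -> Prop) : Prop :=
  P 0 /\ forall (c : K) (u v : L), P u -> P v -> P (c *: u + v).

(* [V a x] reads "x lies in V_a".  The last two clauses state that L is the
   internal direct sum of the V_a; G may be infinite, so the sums range over
   duplicate-free finite lists of degrees. *)
Definition is_grading (V : G -> L -> Prop) : Prop :=
  [/\ forall a, is_subspace (V a),
      forall x : L, exists (s : seq G) (f : G -> L),
        [/\ uniq s, forall a, V a (f a) & x = \sum_(a <- s) f a]
    & forall (s : seq G) (f : G -> L), uniq s -> (forall a, V a (f a)) ->
        \sum_(a <- s) f a = 0 -> forall a, a \in s -> f a = 0].

Definition is_even (V : G -> L -> Prop) (f : L -> L) : Prop :=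
  forall a x, V a x -> V a (f x).

Definition is_bicharacter (eps : G -> G -> K) : Prop :=
  [/\ forall a b, eps a b != 0,
      forall a b, eps a b * eps b a = 1,
      forall a b c, eps a (b + c) = eps a b * eps a c
    & forall a b c, eps (a + b) c = eps a c * eps b c].

End Graded.

Section Brackets.
Variables (G : zmodType) (K : fieldType) (L : lmodType K) (n : nat).

Implicit Types (br : {ffun 'I_n -> L} -> L) (x y : {ffun 'I_n -> L}).

(* (x_1, ..., x_(i-1), u, x_(i+1), ..., x_n) *)
Definition subst_at x (i : 'I_n) (u : L) : {ffun 'I_n -> L} :=
  [ffun j => if j == i then u else x j].

(* (x_1, ..., x_(n-1), z), for n > 0 *)
Definition append_last (x : {ffun 'I_n.-1 -> L}) (z : L) : {ffun 'I_n -> L} :=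
  [ffun i : 'I_n => oapp x z (insub (val i))].

Definition is_multilinear br : Prop :=
  forall x (i : 'I_n) (c : K) (u v : L),
    br (subst_at x i (c *: u + v)) =
    c *: br (subst_at x i u) + br (subst_at x i v).

(* In the next two identities the homogeneous arguments come with a choice of
   degrees.  This only matters for the zero vector, which has every degree:
   when some argument is 0, both sides vanish by multilinearity. *)
Definition color_skew_symmetric (V : G -> L -> Prop) (eps : G -> G -> K) br
    : Prop :=
  forall (d : 'I_n -> G) x, (forall k, V (d k) (x k)) ->
  forall i j : 'I_n, val j = (val i).+1 ->
    br x = - eps (d i) (d j) *: br [ffun k => x (tperm i j k)].

Definition color_hom_Nambu (V : G -> L -> Prop) (eps : G -> G -> K) br
    (alpha : L -> L) : Prop :=
  forall (dx : 'I_n.-1 -> G) (dy : 'I_n -> G)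
         (x : {ffun 'I_n.-1 -> L}) y,
  (forall k, V (dx k) (x k)) -> (forall k, V (dy k) (y k)) ->
    br (append_last [ffun k => alpha (x k)] (br y)) =
    \sum_(i < n) eps (\sum_(k < n.-1) dx k) (\sum_(k < n | (k < i)%N) dy k) *:
      br (subst_at [ffun k => alpha (y k)] i (br (append_last x (y i)))).

Definition preserves_bracket br (f : L -> L) : Prop :=
  forall x, f (br x) = br [ffun k => f (x k)].

(* The bracket is not required to be homogeneous of degree 0. *)
Record is_nHomLieColorAlgebra (V : G -> L -> Prop) br (eps : G -> G -> K)
    (alpha : {linear L -> L}) : Prop := NHomLieColorAlgebra {
  nHLC_grading : is_grading V;
  nHLC_multilinear : is_multilinear br;
  nHLC_bicharacter : is_bicharacter eps;
  nHLC_even : is_even V alpha;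
  nHLC_skew : color_skew_symmetric V eps br;
  nHLC_Nambu : color_hom_Nambu V eps br alpha
}.

Definition is_nLieColorAlgebra (V : G -> L -> Prop) br (eps : G -> G -> K)
    : Prop :=
  is_nHomLieColorAlgebra V br eps (idfun : {linear L -> L}).

Definition is_multiplicative_nHomLieColorAlgebra (V : G -> L -> Prop) br
    (eps : G -> G -> K) (alpha : {linear L -> L}) : Prop :=
  is_nHomLieColorAlgebra V br eps alpha /\ preserves_bracket br alpha.

End Brackets.

(* Main.v *)
(* Since [alpha] preserves the bracket, both sides of the Hom-Nambu identity
   for [alpha \o br] are the images under [alpha \o alpha] of the two sides of
   the Nambu identity for [br]. *)
Require Import Defs.
From mathcomp Require Import all_boot all_algebra perm.
Import GRing.Theory.
Local Open Scope ring_scope.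

(** Multilinearity and skew-symmetry pass to [alpha \o br] by linearity of [alpha]. For Hom-Nambu,
    [subst_at_map] and [append_last_map] exhibit each outer argument tuple as an [alpha]-image, so
    [alpha_endo] can pull [alpha] out of the bracket. *)

Lemma subst_at_map (K : fieldType) (L : lmodType K) (n : nat) (f : L -> L)
    (x : {ffun 'I_n -> L}) (i : 'I_n) (u : L) :
  subst_at [ffun k => f (x k)] i (f u) = [ffun k => f (subst_at x i u k)].
Proof. by apply/ffunP => j; rewrite !ffunE; case: eqP. Qed.

Lemma append_last_map (K : fieldType) (L : lmodType K) (n : nat) (f : L -> L)
    (x : {ffun 'I_n.-1 -> L}) (z : L) :
  append_last [ffun k => f (x k)] (f z) = [ffun k => f (append_last x z k)].
Proof. by apply/ffunP => j; rewrite !ffunE; case: insub => //= k; rewrite ffunE. Qed.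

Theorem corollary3p6 (G : zmodType) (K : fieldType)
    (char_neq2 : 2%N \notin [pchar K]) (n : nat) (n_ge2 : (2 <= n)%N)
    (L : lmodType K) (V : G -> L -> Prop) (br : {ffun 'I_n -> L} -> L)
    (eps : G -> G -> K) (alpha : {linear L -> L})
    (L_nLie : is_nLieColorAlgebra V br eps)
    (alpha_even : is_even V alpha)
    (alpha_endo : preserves_bracket br alpha) :
  is_multiplicative_nHomLieColorAlgebra V
    (fun x : {ffun 'I_n -> L} => alpha (br x)) eps alpha.
Proof.
case: L_nLie => grading multilin bichar _ skew nambu.
split; last by move=> x; rewrite alpha_endo.
split=> //.
- by move=> x i c u v; rewrite multilin linearP.
- by move=> d x Vx i j ij; rewrite (skew d x Vx i j ij) linearZ.
move=> dx dy x y Vx Vy.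
(* Clears the identity twist from the Nambu identity of [br]. *)
have idE (m : nat) (z : {ffun 'I_m -> L}) : [ffun k => idfun (z k)] = z.
  by apply/ffunP => k; rewrite ffunE.
have := nambu dx dy x y Vx Vy; rewrite !idE => nambu_xy.
(* The last slot holds [alpha (br y)], an [alpha]-image like the others; the left side becomes
   [alpha (alpha (br (append_last x (br y))))]. *)
rewrite append_last_map -alpha_endo nambu_xy !linear_sum.
by apply: eq_bigr => i _; rewrite !linearZ /= subst_at_map -alpha_endo.
Qed.
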